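(* Let $k,t$ be positive integers and let $G$ be a finite graph with $\mathrm{mw}_2(G)\le k$ and $\omega(G)\le t$. Then $\chi(G)\le (t+1)!\,k^{2t-2}$.
   Context: $\omega(G)$ is the maximum size of a clique of $G$ and $\chi(G)$ its chromatic number. A merge sequence for a graph $G=(V,E)$ is a sequence $(\mathcal{P}_1,R_1),\dots,(\mathcal{P}_m,R_m)$ where: (1) each $\mathcal{P}_i$ is a partition of $V$, $\mathcal{P}_1$ is the partition into singletons, $\mathcal{P}_m=\{V\}$, and each part of $\mathcal{P}_i$ is a union of parts of $\mathcal{P}_{i-1}$; (2) $R_1\subseteq\dots\subseteq R_m\subseteq\binom{V}{2}$ are sets of unordered pairs of distinct vertices (resolved pairs); (3) for any two (possibly equal) parts $A,B\in\mathcal{P}_i$, the pairs $\{a,b\}$ with $a\in A$, $b\in B$, $a\neq b$, not in $R_i$ are either all edges or all non-edges of $G$. The radius-$r$ width of the sequence is the maximum, over steps $i\ge2$ and vertices $v$, of the number of parts of $\mathcal{P}_{i-1}$ containing a vertex at distance at most $r$ from $v$ in the graph $(V,R_i)$. $\mathrm{mw}_r(G)$ is the minimum radius-$r$ width of a merge sequence for $G$. *)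

(* Defs.v *)
(* Simple finite graphs: T : finType, e : rel T symmetric and irreflexive. *)
From mathcomp Require Import all_boot.
Set Implicit Arguments. Unset Strict Implicit. Unset Printing Implicit Defensive.

Section Graphs.
Variable T : finType.

Definition cliqueb (e : rel T) (K : {set T}) : bool :=
  [forall x in K, forall y in K, (x != y) ==> e x y].

Definition omega (e : rel T) : nat := \max_(K : {set T} | cliqueb e K) #|K|.

Definition colorableb (e : rel T) (n : nat) : bool :=
  [exists f : {ffun T -> 'I_n}, [forall x, forall y, e x y ==> (f x != f y)]].

(* chi(G): least n such that G is n-colourable (#|T| colours always suffice) *)
Definition chi (e : rel T) : nat :=
  \big[minn/#|T|]_(n < #|T|.+1 | colorableb e n) n.

(* A step of a merge sequence: a partition P_i of V and a set R_i of resolved pairs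
   (each resolved pair being a 2-element subset of V). *)
Definition mstep := ({set {set T}} * {set {set T}})%type.

Definition mpart (S : seq mstep) (i : nat) : {set {set T}} := (nth (set0, set0) S i).1.
Definition mres (S : seq mstep) (i : nat) : {set {set T}} := (nth (set0, set0) S i).2.

(* Merge sequence (P_1,R_1),...,(P_m,R_m), stored 0-indexed as S with m = size S. *)
Definition merge_seq (e : rel T) (S : seq mstep) : Prop :=
  let m := size S in
  let P := mpart S in
  let R := mres S in
  0 < m /\
  (forall i, i < m -> partition (P i) [set: T]) /\
  P 0 = [set [set x] | x : T] /\
  P m.-1 = [set [set: T]] /\
  (forall i, 0 < i < m -> forall A, A \in P i ->
     exists Q : {set {set T}}, Q \subset P i.-1 /\ A = cover Q) /\
  (forall i, i.+1 < m -> R i \subset R i.+1) /\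
  (forall i, i < m -> R i \subset [set X : {set T} | #|X| == 2]) /\
  (forall i, i < m -> forall A B, A \in P i -> B \in P i ->
     (forall a b, a \in A -> b \in B -> a != b -> [set a; b] \notin R i -> e a b) \/
     (forall a b, a \in A -> b \in B -> a != b -> [set a; b] \notin R i -> ~~ e a b)).

Definition rball (R : {set {set T}}) (r : nat) (v : T) : {set T} :=
  iter r (fun X : {set T} => X :|: [set w | [exists u in X, [set u; w] \in R]]) [set v].

Definition rwidth_le (r k : nat) (S : seq mstep) : Prop :=
  forall i, 0 < i < size S -> forall v : T,
    #|[set A in mpart S i.-1 | [exists w in A, w \in rball (mres S i) r v]]| <= k.

Definition mw_le (e : rel T) (r k : nat) : Prop :=
  exists S : seq mstep, merge_seq e S /\ rwidth_le r k S.

End Graphs.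

(* Main.v *)
(* Induction on t, for the subgraph of G induced by a vertex set W. Let part v
   be the largest block around v met by W in clique number less than t: inside
   each of these parts the induction hypothesis applies. The edges between
   parts get two more colourings, and the three colours are combined.
   - Edges still unresolved one step after the first of the two parts dies. By
     then that part lies in a block containing a t-clique K of W, and if u is
     in that block and uv is an unresolved edge then v is in K or resolved with
     some vertex of K, since otherwise v would extend K. Hence a part has at
     most t k such neighbours among the parts that live at least as long, and
     t k + 1 colours suffice.
   - Edges between two parts with no edge of the first kind. Let partH v be the
     last block around v that has such an edge uz unresolved. By homogeneity and
     maximality the whole block is resolved with the single vertex z one step
     later, so the radius-2 ball of z meets all its neighbours; at most k
     blocks, itself included, are met, and k colours suffice. *)
Require Import Defs.
From mathcomp Require Import all_boot zify.
Set Implicit Arguments. Unset Strict Implicit. Unset Printing Implicit Defensive.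

(** A vertex of minimal rank in the remaining set has all its neighbours there counted by the degree
    bound. Coloured after the others, it finds one of the [d.+1] colours free. *)
Lemma greedy_coloring (C : finType) (adj : rel C) (rk : C -> nat) (d : nat) :
    symmetric adj ->
    (forall c, #|[set c' | [&& c' != c, rk c <= rk c' & adj c c']]| <= d) ->
  exists f : C -> 'I_d.+1, forall c c', c != c' -> adj c c' -> f c != f c'.
Proof.
move=> adjC deg.
suff H n (A : {set C}) : #|A| = n -> exists f : C -> 'I_d.+1,
    {in A &, forall c c', c != c' -> adj c c' -> f c != f c'}.
  by have [f fP] := H _ setT erefl; exists f => c c'; apply: fP; rewrite inE.
elim: n A => [|n IHn] A cardA.
  by exists (fun=> ord0) => c c'; rewrite (cards0_eq cardA) inE.
have /card_gt0P[c0 c0A] : 0 < #|A| by rewrite cardA.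
case: (arg_minnP rk c0A) => c; rewrite -/(c \in A) => cA cmin.
have [|f fP] := IHn (A :\ c).
  by have := cardsD1 c A; rewrite cA cardA => -[].
pose N := [set c' | [&& c' != c, rk c <= rk c' & adj c c']].
have [a aN] : exists a, a \notin f @: N.
  apply/existsP; rewrite -negb_forall; apply/negP => /forallP fN.
  have : #|'I_d.+1| <= #|f @: N|.
    by apply: subset_leq_card; apply/subsetP => x _; apply: fN.
  by rewrite card_ord leqNgt ltnS (leq_trans (leq_imset_card _ _) (deg c)).
have new x : x \in A -> x != c -> adj c x -> f x != a.
  move=> xA xc cx; apply: contraNneq aN => <-.
  by apply: imset_f; rewrite inE xc cx cmin.
exists (fun x => if x == c then a else f x) => x y xA yA.
case: (eqVneq x c) => [->|xc]; case: (eqVneq y c) => [->|yc] //.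
- by move=> _ cy; rewrite eq_sym new.
- by rewrite adjC => _; apply: new.
by apply: fP; rewrite !inE ?xc ?yc.
Qed.

(** * Classes of a nested family of partitions *)

Section Levels.
Variables (T : finType) (m : nat) (blk : nat -> T -> {set T}).
Hypotheses (m_gt0 : 0 < m)
  (blk_self : forall i v, i < m -> v \in blk i v)
  (blk_eq : forall i u v, i < m -> u \in blk i v -> blk i u = blk i v)
  (blk_sub : forall i j v, i <= j -> j < m -> blk i v \subset blk j v).

(* [level Q v] is the last time at which the block of [v] satisfies [Q]; it is
   also 0 when this never happens, so that [class Q v] is then the initial
   block of [v]. *)
Definition level (Q : nat -> {set T} -> bool) (v : T) : nat :=
  \max_(i < m | Q i (blk i v)) i.

Definition class (Q : nat -> {set T} -> bool) (v : T) : {set T} :=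
  blk (level Q v) v.

Variable Q : nat -> {set T} -> bool.

Lemma level_lt v : level Q v < m.
Proof.
rewrite -(ltn_predK m_gt0) ltnS; apply/bigmax_leqP => i _.
by rewrite -ltnS (ltn_predK m_gt0).
Qed.

Lemma after_level i v : level Q v < i -> i < m -> ~~ Q i (blk i v).
Proof.
move=> li im; apply/negP => Qi.
have := @leq_bigmax_cond _ (fun j : 'I_m => Q j (blk j v)) val (Ordinal im) Qi.
by rewrite leqNgt li.
Qed.

Lemma levelP v :
  Q (level Q v) (class Q v) \/
  level Q v = 0 /\ forall i, i < m -> ~~ Q i (blk i v).
Proof.
case: (pickP (fun i : 'I_m => Q i (blk i v))) => [i0 Qi0|noQ]; last first.
  right; split; first by rewrite /level big_pred0.
  by move=> i im; have /= -> := noQ (Ordinal im).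
left; rewrite /class /level (bigmax_eq_arg i0) //.
by case: arg_maxnP.
Qed.

Lemma class_self v : v \in class Q v.
Proof. exact: blk_self (level_lt v). Qed.

Lemma blk_eq_le i j u v : i <= j -> j < m -> u \in blk i v -> blk j u = blk j v.
Proof. by move=> ij jm /(subsetP (blk_sub v ij jm)); apply: blk_eq. Qed.

(** From time [level Q v] on, [u] and [v] share their block, so [Q] holds for both at the same later
    times. *)
Lemma level_class u v : u \in class Q v -> level Q u = level Q v.
Proof.
move=> uv; have E i : level Q v <= i -> i < m -> blk i u = blk i v.
  by move=> li im; apply: blk_eq_le uv.
apply/eqP; rewrite eqn_leq; apply/andP; split.
  apply/bigmax_leqP => i Qi; rewrite leqNgt; apply/negP => li.
  by have := after_level li (ltn_ord i); rewrite -E ?Qi // ltnW.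
case: (levelP v) => [Qv|[-> //]].
rewrite leqNgt; apply/negP => luv.
by have := after_level luv (level_lt v); rewrite E ?level_lt // Qv.
Qed.

Lemma class_eq u v : u \in class Q v -> class Q u = class Q v.
Proof.
move=> uv; rewrite /class (level_class uv).
exact: blk_eq (level_lt v) uv.
Qed.

(** Greedy colouring of the classes, ranked by level. A class of no smaller level is a union of
    blocks of time [level Q v], so distinct neighbouring classes give distinct blocks in [D], none
    of them [class Q v]. *)
Lemma class_coloring (adj : rel T) (d : nat) :
    symmetric adj ->
    (forall v, exists2 D : {set {set T}}, #|D :\ class Q v| <= d &
       forall u w, u \in class Q v -> class Q w != class Q v ->
         level Q v <= level Q w -> adj u w -> blk (level Q v) w \in D) ->
  exists f : {set T} -> 'I_d.+1,
    forall u w, adj u w -> class Q u != class Q w ->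
      f (class Q u) != f (class Q w).
Proof.
move=> adjC few.
pose rk (A : {set T}) := if [pick x in A] is Some x then level Q x else 0.
have rk_class v : rk (class Q v) = level Q v.
  rewrite /rk; case: pickP => [x /level_class //|/(_ v)].
  by rewrite class_self.
pose Adj (A B : {set T}) :=
  [exists u, exists w, [&& A == class Q u, B == class Q w & adj u w]].
have AdjP u w : adj u w -> Adj (class Q u) (class Q w).
  by move=> uw; apply/existsP; exists u; apply/existsP; exists w; rewrite !eqxx.
have AdjC : symmetric Adj.
  move=> A B; apply/idP/idP => /existsP[u /existsP[w /and3P[/eqP-> /eqP-> uw]]];
  by apply: AdjP; rewrite adjC.
have [A|f fP] := @greedy_coloring _ Adj rk d AdjC; last first.
  by exists f => u w uw uw'; apply: fP (AdjP _ _ uw).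
set N := finset _.
case: (set_0Vmem N) => [->|[B]]; first by rewrite cards0.
rewrite inE => /and3P[_ _ /existsP[v /existsP[_ /and3P[/eqP AE _ _]]]].
have [D Dd DP] := few v.
(* [g] recovers a class from any block inside it; [set0] is a dummy value. *)
pose g (B : {set T}) := if [pick x in B] is Some x then class Q x else set0.
apply: leq_trans (leq_trans (leq_imset_card g _) Dd).
apply: subset_leq_card; apply/subsetP => {}B; rewrite inE => /and3P[].
move=> BA rkB /existsP[u /existsP[w /and3P[/eqP Au /eqP Bw uw]]].
move: BA rkB Au; rewrite {}AE {}Bw !rk_class => wv lvw vu.
have gw : g (blk (level Q v) w) = class Q w.
  rewrite /g; case: pickP => [x xw|/(_ w)]; last by rewrite blk_self ?level_lt.
  by apply: class_eq; apply: subsetP xw; apply: blk_sub lvw (level_lt w).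
rewrite -gw; apply: imset_f; rewrite !inE (DP u) // ?vu ?class_self // andbT.
apply: contraNneq wv => wv; apply/eqP/class_eq.
by have := blk_self w (level_lt v); rewrite wv vu.
Qed.
End Levels.

(** * Colourability of vertex subsets and the colour count *)

Definition colorable_on (T : finType) (e : rel T) (W : {set T}) (n : nat) :=
  exists f : T -> 'I_n, {in W &, forall x y, e x y -> f x != f y}.

Lemma colorable_on_codom (T C : finType) (e : rel T) (W : {set T}) (n : nat)
    (f : T -> C) :
    #|C| <= n -> {in W &, forall x y, e x y -> f x != f y} ->
  colorable_on e W n.
Proof.
move=> Cn fP; exists (fun x => widen_ord Cn (enum_rank (f x))) => x y xW yW xy.
apply: contraNneq (fP x y xW yW xy) => /(congr1 val) /= /val_inj.
by move/enum_rank_inj->.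
Qed.

Lemma bigminn_le (I : eqType) (r : seq I) (P : pred I) (F : I -> nat) (x0 : nat)
    (i : I) : i \in r -> P i -> \big[minn/x0]_(j <- r | P j) F j <= F i.
Proof.
move=> + Pi; elim: r => // j r IHr; rewrite inE big_cons => /predU1P[<-|/IHr le].
  by rewrite Pi geq_minl.
by case: ifP => // _; apply: leq_trans le; apply: geq_minr.
Qed.

Lemma chi_le (T : finType) (e : rel T) (n : nat) :
  colorable_on e setT n -> chi e <= n.
Proof.
move=> [f fP]; rewrite /chi; case: (leqP n #|T|) => [nT|/ltnW Tn].
  apply: (@bigminn_le _ _ _ val _ (Ordinal (nT : n < #|T|.+1))).
    exact: mem_index_enum.
  apply/existsP; exists [ffun x => f x]; apply/forallP => x; apply/forallP => y.
  by apply/implyP => xy; rewrite !ffunE fP ?inE.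
apply: leq_trans Tn; elim/big_ind: _ => // [x y _|i _]; last by rewrite -ltnS.
by apply: leq_trans; apply: geq_minr.
Qed.

(** Passes from the bound for [t = s.+1] to that for [t = s.+2], by [s.+2 * k + 1 <= s.+3 * k]. *)
Lemma color_count (s k : nat) : 0 < k ->
  (s.+2 * k).+1 * k * (s.+2`! * k ^ (2 * s)) <= s.+3`! * k ^ (2 * s.+1).
Proof.
move=> k_gt0; rewrite mulnS expnD (factS s.+2).
have -> : s.+3 * s.+2`! * (k ^ 2 * k ^ (2 * s)) =
  s.+3 * k ^ 2 * (s.+2`! * k ^ (2 * s)) by lia.
by apply: leq_mul => //; rewrite -mulnn mulnA leq_mul2r; apply/orP; right; nia.
Qed.

(** * Colouring along a merge sequence *)

Section MergeSequence.
Variables (T : finType) (e : rel T) (k : nat) (S : seq (mstep T)).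
Hypotheses (eC : symmetric e) (e_irr : irreflexive e) (k_gt0 : 0 < k)
  (S_merge : merge_seq e S) (S_width : rwidth_le 2 k S) (S_gt1 : 1 < size S).

Let blk (i : nat) (v : T) : {set T} := pblock (mpart S i) v.
Let res (i : nat) (u v : T) : bool := [set u; v] \in mres S i.
Let m_gt0 : 0 < size S := ltnW S_gt1.

(** * Blocks, resolved pairs and homogeneity *)

Lemma part_P i : i < size S -> partition (mpart S i) [set: T].
Proof. by case: S_merge => _ [+ _]; apply. Qed.

Lemma blk_mem i v : i < size S -> blk i v \in mpart S i.
Proof.
by move=> /part_P /and3P[/eqP cov _ _]; rewrite pblock_mem // cov inE.
Qed.

Lemma blk_self i v : i < size S -> v \in blk i v.
Proof. by move=> /part_P /and3P[/eqP cov _ _]; rewrite mem_pblock cov inE. Qed.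

Lemma blk_def i A v : i < size S -> A \in mpart S i -> v \in A -> blk i v = A.
Proof. by move=> /part_P /and3P[_ triv _]; apply: def_pblock. Qed.

Lemma blk_eq i u v : i < size S -> u \in blk i v -> blk i u = blk i v.
Proof. by move=> im; apply: blk_def (blk_mem v im). Qed.

Lemma blk_sub i j v : i <= j -> j < size S -> blk i v \subset blk j v.
Proof.
move=> /subnK <-; elim: (j - i) => // d IHd dm.
have dm' : d + i < size S by apply: ltnW.
apply: subset_trans (IHd dm') _; rewrite addSn.
have [_ [_ [_ [_ [refines _]]]]] := S_merge.
have [Q [QP E]] := refines (d + i).+1 dm _ (blk_mem v dm).
have : v \in cover Q by rewrite -E blk_self.
case/bigcupP => B BQ vB; rewrite (blk_def dm' (subsetP QP _ BQ) vB) E.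
exact: bigcup_sup BQ.
Qed.

Lemma blk_first v : blk 0 v = [set v].
Proof.
have [_ [_ [P0 _]]] := S_merge.
by apply: blk_def; rewrite ?P0 ?inE ?imset_f.
Qed.

Lemma blk_last v : blk (size S).-1 v = setT.
Proof.
have [_ [_ [_ [PT _]]]] := S_merge.
by apply: blk_def; rewrite ?PT ?inE // ltn_predL.
Qed.

Lemma res_sym i u v : res i u v = res i v u.
Proof. by rewrite /res setUC. Qed.

Lemma res_mono i j u v : i <= j -> j < size S -> res i u v -> res j u v.
Proof.
move=> /subnK <-; elim: (j - i) => // d IHd dm uv.
have [_ [_ [_ [_ [_ [mono _]]]]]] := S_merge.
by apply: (subsetP (mono _ dm)); apply: IHd uv; apply: ltnW.
Qed.

Lemma homogeneous i a b a' b' : i < size S -> e a b -> ~~ res i a b ->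
  a' \in blk i a -> b' \in blk i b -> a' != b' -> ~~ res i a' b' -> e a' b'.
Proof.
move=> im ab ab_unres a'a b'b ab' ab'_unres.
have [_ [_ [_ [_ [_ [_ [_ homog]]]]]]] := S_merge.
have [edge|nonedge] := homog i im _ _ (blk_mem a im) (blk_mem b im).
  exact: edge.
have ab_neq : a != b by apply: contraTneq ab => ->; rewrite e_irr.
by have := nonedge a b (blk_self a im) (blk_self b im) ab_neq ab_unres; rewrite ab.
Qed.

(** The width counts blocks of time [i] against resolved pairs of time [i.+1]. *)
Let touched (i : nat) (v : T) : {set {set T}} :=
  [set blk i w | w in rball (mres S i.+1) 2 v].

Lemma touched_card i v : i.+1 < size S -> #|touched i v| <= k.
Proof.
move=> im; apply: leq_trans (S_width (i := i.+1) im v).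
apply: subset_leq_card; apply/subsetP => _ /imsetP[w wv ->].
have im' := ltnW im; rewrite inE blk_mem //=.
by apply/existsP; exists w; rewrite blk_self.
Qed.

Lemma touched0 i v : blk i v \in touched i v.
Proof. by apply: imset_f; rewrite /rball /= !inE eqxx. Qed.

Lemma touched1 i v w : res i.+1 v w -> blk i w \in touched i v.
Proof.
move=> vw; apply: imset_f; rewrite /rball /= !inE; apply/orP; left.
by apply/orP; right; apply/existsP; exists v; rewrite !inE eqxx.
Qed.

Lemma touched2 i v u w :
  res i.+1 v u -> res i.+1 u w -> blk i w \in touched i v.
Proof.
move=> vu uw; apply: imset_f; rewrite /rball /= !inE; apply/orP; right.
apply/existsP; exists u; rewrite !inE; apply/andP; split=> //.
by apply/orP; right; apply/existsP; exists v; rewrite !inE eqxx.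
Qed.

Definition cliques_le (X : {set T}) (n : nat) : bool :=
  [forall K : {set T}, (K \subset X) && cliqueb e K ==> (#|K| <= n)].

(** * Parts of smaller clique number and the edges left unresolved *)

Variables (W : {set T}) (s : nat).
Hypothesis W_cliques : cliques_le W s.+2.

Let few_cliques (i : nat) (B : {set T}) : bool := cliques_le (B :&: W) s.+1.
Let lvl : T -> nat := level (size S) blk few_cliques.
Let part : T -> {set T} := class (size S) blk few_cliques.

Lemma lvl_lt v : lvl v < size S.
Proof. exact: level_lt blk m_gt0 few_cliques v. Qed.

Lemma part_self v : v \in part v.
Proof. exact: class_self m_gt0 blk_self few_cliques v. Qed.

Lemma part_eq u v : u \in part v -> part u = part v.
Proof. exact: (class_eq m_gt0 blk_eq blk_sub). Qed.

Lemma lvl_eq u v : u \in part v -> lvl u = lvl v.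
Proof. exact: (level_class m_gt0 blk_eq blk_sub). Qed.

Lemma part_cliques v : cliques_le (part v :&: W) s.+1.
Proof.
have [//|[l0 _]] := levelP (size S) blk few_cliques v.
rewrite /part /class l0 blk_first; apply/forallP => K; apply/implyP => /andP[].
by rewrite subsetI => /andP[/subset_leq_card + _] _; rewrite cards1; lia.
Qed.

(* The last time at which the parts of [u] and [v] are both blocks. *)
Let ends (u v : T) : nat := minn (lvl u) (lvl v).

(** At the last time every block is [setT], so distinct parts cannot both live until then. *)
Lemma ends_lt u v : part u != part v -> (ends u v).+1 < size S.
Proof.
have := lvl_lt u; have := lvl_lt v; rewrite /ends => lv lu.
apply: contraNltn => le; apply/eqP; rewrite /part /class -/(lvl u) -/(lvl v).
have -> : lvl u = (size S).-1 by lia.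
have -> : lvl v = (size S).-1 by lia.
by rewrite !blk_last.
Qed.

Let adjU (u v : T) : bool :=
  [&& u \in W, v \in W, e u v & ~~ res (ends u v).+1 u v].

Lemma adjUC : symmetric adjU.
Proof.
by move=> u v; rewrite /adjU eC res_sym /ends minnC andbCA.
Qed.

Lemma adjU_coloring : exists f : {set T} -> 'I_(s.+2 * k).+1,
  forall u w, adjU u w -> part u != part w -> f (part u) != f (part w).
Proof.
apply: (class_coloring m_gt0 blk_self blk_eq blk_sub).
  exact: adjUC.
move=> v; rewrite -/(lvl v) -/(part v).
case: (ltnP (lvl v).+1 (size S)) => [lm|ml]; last first.
  exists set0 => [|u w _ /ends_lt]; first by rewrite set0D cards0.
  by rewrite /ends -/(lvl w) => wm vw; lia.
have := after_level (Q := few_cliques) (ltnSn (lvl v)) lm.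
case/forallPn => K; rewrite negb_imply -ltnNge => /andP[/andP[KBW K_clique] K_card].
have K_card' : #|K| <= s.+2.
  move/forallP/(_ K)/implyP: W_cliques; apply; rewrite K_clique andbT.
  by apply: subset_trans KBW _; apply: subsetIr.
exists (\bigcup_(x in K) touched (lvl v) x) => [|u w uv wv vw uw].
  apply: leq_trans (subset_leq_card (subD1set _ _)) _.
  apply: (@leq_trans (#|K| * k)); last by rewrite leq_mul2r K_card' orbT.
  rewrite -sum_nat_const; elim/big_rec2: _ => [|x B n xK nB]; first by rewrite cards0.
  exact: leq_trans (leq_card_setU _ _) (leq_add (touched_card x lm) nB).
case/and4P: uw => uW wW uw; rewrite /ends (lvl_eq uv) (minn_idPl vw) => uw_unres.
have [x xK xw] : exists2 x, x \in K & (w == x) || res (lvl v).+1 x w.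
  apply/exists_inP; rewrite -[X in is_true X]negbK negb_exists_in.
  apply/negP => /forall_inP far.
  (* Otherwise [w] would extend [K] to a clique of size [s.+3]. *)
  have K_far x : x \in K -> [/\ x \in W, w != x & e w x].
    move=> xK; move/subsetP/(_ x xK): KBW; rewrite inE => /andP[xB xW].
    have := far x xK; rewrite negb_or => /andP[wx xw]; split=> //.
    (* At time [(lvl v).+1] the vertices [x] and [u] share a block, so the unresolved edge [wu]
       forces the edge [wx]. *)
    apply: (homogeneous lm _ _ (blk_self w lm) _ wx).
    - by rewrite eC; apply: uw.
    - by rewrite res_sym.
    - by rewrite (blk_eq_le blk_eq blk_sub _ _ uv) ?leqnSn.
    - by rewrite res_sym.
  have wK : w \notin K by apply/negP => /K_far[_]; rewrite eqxx.
  move/forallP/(_ (w |: K))/implyP: W_cliques.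
  have ltK : s.+1 < #|K| := K_card.
  suff -> : (w |: K \subset W) && cliqueb e (w |: K).
    by move=> /(_ isT); rewrite cardsU1 wK; lia.
  apply/andP; split.
    by rewrite subUset sub1set wW; apply/subsetP => x /K_far[].
  apply/forall_inP => x; rewrite inE in_set1 => xK; apply/forall_inP => y.
  rewrite inE in_set1 => yK; apply/implyP => xy.
  case/orP: xK xy => [/eqP->|xK]; case/orP: yK => [/eqP->|yK]; rewrite ?eqxx //.
  - by case: (K_far y yK).
  - by rewrite eC; case: (K_far x xK).
  by move/forall_inP/(_ x xK)/forall_inP/(_ y yK)/implyP: K_clique; apply.
apply/bigcupP; exists x => //; case/orP: xw => [/eqP->|]; first exact: touched0.
exact: touched1.
Qed.

(* Forbidding [adjU] edges between the whole parts, rather than for the pair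
   alone, makes every edge between these two parts an [adjH] edge. *)
Let adjH (u v : T) : bool :=
  [&& u \in W, v \in W, e u v, part u != part v &
      [forall x in part u, forall y in part v, ~~ adjU x y]].

Lemma adjHC : symmetric adjH.
Proof.
suff H u v : adjH u v -> adjH v u by move=> u v; apply/idP/idP; apply: H.
case/and5P => uW vW uv uv' noU; rewrite /adjH uW vW eC uv eq_sym uv' /=.
apply/forall_inP => y yv; apply/forall_inP => x xu; rewrite adjUC.
by move/forall_inP/(_ x xu)/forall_inP/(_ y yv): noU.
Qed.

Lemma adjH_res u v : adjH u v -> res (ends u v).+1 u v.
Proof.
case/and5P => uW vW uv _ /forall_inP/(_ u (part_self u)).
move/forall_inP/(_ v (part_self v)).
by rewrite /adjU uW vW uv /= negbK.
Qed.

(** * The classes [partH] and the resolved edges between parts *)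

Let unresolvedH (i : nat) (B : {set T}) : bool :=
  [exists u in B, exists z, adjH u z && ~~ res i u z].
Let lvlH : T -> nat := level (size S) blk unresolvedH.
Let partH : T -> {set T} := class (size S) blk unresolvedH.

Lemma lvlH_lt v : lvlH v < size S.
Proof. exact: level_lt blk m_gt0 unresolvedH v. Qed.

Lemma partH_self v : v \in partH v.
Proof. exact: class_self m_gt0 blk_self unresolvedH v. Qed.

Lemma partH_eq u v : u \in partH v -> partH u = partH v.
Proof. exact: (class_eq m_gt0 blk_eq blk_sub). Qed.

Lemma lvlH_eq u v : u \in partH v -> lvlH u = lvlH v.
Proof. exact: (level_class m_gt0 blk_eq blk_sub). Qed.

Lemma adjH_after i u v : lvlH u < i -> i < size S -> adjH u v -> res i u v.
Proof.
move=> ui im uv; have := after_level (Q := unresolvedH) ui im.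
apply: contraR => uv_unres; apply/exists_inP; exists u; first exact: blk_self.
by apply/existsP; exists v; rewrite uv.
Qed.

(** An [adjH] edge [uz] is resolved right after the first of its parts dies. If it is unresolved at
    time [lvlH v], then [lvlH v <= lvl u] by monotonicity. *)
Lemma partH_sub v : partH v \subset part v.
Proof.
have [/exists_inP[u uv]|[l0 _]] := levelP (size S) blk unresolvedH v; last first.
  by rewrite /partH /class l0 blk_first sub1set part_self.
case/existsP => z /andP[uz uz_unres].
have le : lvlH v <= lvl u.
  rewrite leqNgt; apply: contra uz_unres => lt.
  apply: res_mono (adjH_res uz); last exact: lvlH_lt.
  by rewrite (leq_trans _ lt) // ltnS geq_minl.
rewrite -/(partH v) -(partH_eq uv) /partH /class -/(lvlH u) (lvlH_eq uv).
have sub : blk (lvlH v) u \subset part u by apply: blk_sub le (lvl_lt u).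
rewrite (part_eq (u := v) (v := u)) //; apply: (subsetP sub).
by rewrite (blk_eq (lvlH_lt v) uv) blk_self ?lvlH_lt.
Qed.

Lemma adjH_partH u w : adjH u w -> partH u != partH w.
Proof.
case/and5P => _ _ _ uw _; apply: contraNneq uw => E; apply/eqP.
by apply: part_eq; apply: (subsetP (partH_sub w)); rewrite -E partH_self.
Qed.

Lemma adjH_coloring : exists f : {set T} -> 'I_k,
  forall u w, adjH u w -> f (partH u) != f (partH w).
Proof.
(* One of the at most [k] touched blocks is [partH v] itself, leaving [k.-1] neighbours. *)
rewrite -(prednK k_gt0).
suff [f fP] : exists f : {set T} -> 'I_k.-1.+1, forall u w, adjH u w ->
    partH u != partH w -> f (partH u) != f (partH w).
  by exists f => u w uw; apply: fP (uw) (adjH_partH uw).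
apply: (class_coloring m_gt0 blk_self blk_eq blk_sub).
  exact: adjHC.
move=> v; rewrite -/(lvlH v) -/(partH v).
suff [z zm [vz zP]] : exists2 z, (lvlH v).+1 < size S &
    partH v \in touched (lvlH v) z /\
    forall u w, u \in partH v -> adjH u w -> blk (lvlH v) w \in touched (lvlH v) z.
  exists (touched (lvlH v) z) => [|u w uv _ _ uw]; last exact: zP uv uw.
  have := touched_card z zm; rewrite (cardsD1 (partH v)) vz add1n.
  by rewrite -{1}(prednK k_gt0) ltnS.
have [/exists_inP[u uv]|[l0 noU]] := levelP (size S) blk unresolvedH v; last first.
  (* Default case: [partH v] is the singleton of [v], and [z = v] works since all its [adjH] edges
     are resolved at time 1. *)
  have lH : lvlH v = 0 := l0.
  rewrite /partH /class -/(lvlH v) lH; exists v => //.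
  split; first exact: touched0.
  move=> u w; rewrite blk_first inE => /eqP-> vw; apply: touched1.
  by apply: adjH_after vw => //; rewrite lH.
rewrite -/(lvlH v) => /existsP[z /andP[uz uz_unres]].
have [_ _ e_uz uz_part noU] := and5P uz.
have lm : (lvlH v).+1 < size S.
  apply: leq_ltn_trans (ends_lt uz_part); rewrite ltnNge.
  by apply: contra uz_unres => le; apply: res_mono le (lvlH_lt v) (adjH_res uz).
(* If [az] is still unresolved, homogeneity makes it an edge; as [a] and [u] share their part, it is
   an [adjH] edge, hence resolved one step later. *)
have z_near a : a \in partH v -> a \in W -> res (lvlH v).+1 z a.
  move=> av aW; have a_part : part a = part u.
    rewrite (part_eq (subsetP (partH_sub v) _ av)).
    by rewrite (part_eq (subsetP (partH_sub v) _ uv)).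
  have la : lvlH a = lvlH v := lvlH_eq av.
  rewrite res_sym; case: (boolP (res (lvlH v) a z)) => [|az_unres].
    exact: res_mono (leqnSn _) lm.
  apply: adjH_after lm _; first by rewrite la.
  have zW : z \in W by case/and5P: uz.
  rewrite /adjH aW zW a_part uz_part noU !andbT.
  apply: (homogeneous (lvlH_lt v) e_uz uz_unres _ (blk_self z (lvlH_lt v)) _ az_unres).
    by rewrite (blk_eq (lvlH_lt v) uv).
  by apply: contraNneq uz_part => <-; rewrite a_part.
exists z => //; split=> [|a w av aw].
  rewrite /partH /class -/(lvlH v) -(blk_eq (lvlH_lt v) uv).
  by apply: touched1; apply: z_near => //; case/and5P: uz.
(* The resolved path [z], [a], [w] is where radius 2 is needed. *)
apply: (touched2 (u := a)); first by apply: z_near => //; case/and5P: aw.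
by apply: adjH_after lm aw; rewrite (lvlH_eq av).
Qed.

Lemma colorable_on_step (N : nat) :
    (forall W', cliques_le W' s.+1 -> colorable_on e W' N) ->
  colorable_on e W ((s.+2 * k).+1 * k * N).
Proof.
move=> IH; have [fU fUP] := adjU_coloring; have [fH fHP] := adjH_coloring.
have /(@fin_all_exists _ (fun=> T -> 'I_N))[f fP] (A : {set T}) :
    exists f : T -> 'I_N, cliques_le (A :&: W) s.+1 ->
      {in A :&: W &, forall x y, e x y -> f x != f y}.
  case: (boolP (cliques_le (A :&: W) s.+1)) => [/IH[f fP]|_]; first by exists f.
  (* Any function serves here; the empty set supplies one even though ['I_N] is not known to be
     inhabited. *)
  have [|f _] := IH set0; last by exists f.
  apply/forallP => K; apply/implyP => /andP[].
  by rewrite subset0 => /eqP-> _; rewrite cards0.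
apply: (@colorable_on_codom _ ('I_(s.+2 * k).+1 * 'I_k * 'I_N)%type _ _ _
  (fun v => (fU (part v), fH (partH v), f (part v) v))).
  by rewrite !card_prod !card_ord.
move=> u v uW vW uv; rewrite !xpair_eqE !negb_and.
case: (eqVneq (part u) (part v)) => [E|uv'].
  apply/orP; right; rewrite E; apply: fP (part_cliques v) _ _ _ _ uv.
    by rewrite inE uW -E part_self.
  by rewrite inE vW part_self.
case: (boolP [forall x in part u, forall y in part v, ~~ adjU x y]) => [noU|].
  by rewrite fHP ?orbT // /adjH uW vW uv uv' noU.
(* The edge [uv] need not be in [adjU], but some [xy] between the same parts is, and [fU] only sees
   the parts. *)
case/forall_inPn => x xu /forall_inPn[y yv]; rewrite negbK => xy.
by rewrite -(part_eq xu) -(part_eq yv) fUP // (part_eq xu) (part_eq yv).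
Qed.

End MergeSequence.

Theorem theorem1p2 (T : finType) (e : rel T) (k t : nat) :
  symmetric e -> irreflexive e -> 0 < k -> 0 < t ->
  mw_le e 2 k -> omega e <= t ->
  chi e <= (t.+1)`! * k ^ (2 * t - 2).
Proof.
move=> eC e_irr k_gt0; case: t => // s _ [S [S_merge S_width]] e_omega.
have -> : 2 * s.+1 - 2 = 2 * s by lia.
apply: chi_le; have : cliques_le e setT s.+1.
  apply/forallP => K; apply/implyP => /andP[_ K_clique].
  by apply: leq_trans e_omega; rewrite /omega (bigmax_sup K).
move: setT {e_omega}; elim: s => [|s IHs] W W_cliques.
  (* For [t = 1] an edge inside [W] would be a clique of size 2, so one colour suffices. *)
  apply: (@colorable_on_codom _ unit _ _ _ (fun=> tt)) => [|x y xW yW xy].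
    by rewrite card_unit muln1.
  suff pair : ([set x; y] \subset W) && cliqueb e [set x; y].
    have xy' : x != y by apply: contraTneq xy => ->; rewrite e_irr.
    by move/forallP/(_ [set x; y])/implyP/(_ pair): W_cliques; rewrite cards2 xy'.
  rewrite subUset !sub1set xW yW /=.
  apply/forall_inP => a; rewrite !inE => /orP[]/eqP->; apply/forall_inP => b;
    by rewrite !inE => /orP[]/eqP->; rewrite ?eqxx // ?xy 1?eC ?xy implybT.
case: (ltnP 1 (size S)) => [S_gt1|S_le1].
  have [f fP] := colorable_on_step eC e_irr k_gt0 S_merge S_width S_gt1 W_cliques IHs.
  by apply: colorable_on_codom fP; rewrite card_ord color_count.
(* With a single step the partition into singletons is also [[set setT]], so there is only one
   vertex. *)
apply: (@colorable_on_codom _ unit _ _ _ (fun=> tt)) => [|x y _ _].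
  by rewrite card_unit muln_gt0 fact_gt0 expn_gt0 k_gt0.
have [S_gt0 [_ [P0 [PT _]]]] := S_merge.
have S1 : (size S).-1 = 0 by lia.
move: PT; rewrite S1 P0 => PT.
have : [set x] \in [set [set x0] | x0 : T] by apply: imset_f.
rewrite PT inE => /eqP/setP/(_ y); rewrite !inE => /eqP->.
by rewrite e_irr.
Qed.
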